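(* Let $n_z\ge 2$ and $n_s\ge 1$ be integers and $\eta\in(\tfrac12,1]$. Let $P(X,S,Z)$ (the true distribution) and $Q(X,S,Z)$ (any other distribution) be joint distributions of an observed variable $X\in\mathbb{X}\subseteq\mathbb{R}^{n_x}$, a discrete proxy variable $S\in[n_s]$ and a latent variable $Z\in[n_z]$. Suppose that the marginals over $(X,S)$ agree, $P(X,S)=Q(X,S)$, and that each of $P$ and $Q$ satisfies the following three assumptions (stated for $P$; the same with $Q$ in place of $P$): 1. (Structural constraints) $S\perp X\mid Z$. 2. (Proxy distribution rank) The $n_z\times n_s$ matrix $M$ with entries $M_{zs}=P(S=s\mid Z=z)$ has rank $n_z$. 3. (Weak overlap) For each $i\in\{1,\dots,n_z\}$, $\max_{x}P(Z=i\mid X=x)\ge\eta$. Then there exists a permutation $\pi$ of $\{1,\dots,n_z\}$ such that for each $i\in\{1,\dots,n_z\}$, $$\sup_{x\in\mathrm{supp}(X)}\bigl|P(Z=i\mid X=x)-Q(Z=\pi(i)\mid X=x)\bigr|\;\le\; O\!\left(\frac{1-\eta}{2\eta-1}\right),$$ that is, the left-hand side is at most $C\cdot\frac{1-\eta}{2\eta-1}$ for a constant $C$ depending only on $n_z$.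
   Context: Notation: $[n]=\{1,\dots,n\}$. $\mathrm{supp}(X)$ is the support of the (common) marginal law of $X$, and the maximum over $x$ in the weak overlap assumption is over $x\in\mathrm{supp}(X)$. Conditional distributions given $X=x$ are understood as functions defined for every $x\in\mathrm{supp}(X)$, with the identities between conditional distributions implied by the hypotheses holding for every such $x$: $P(S\mid X=x)=Q(S\mid X=x)$, and, by $S\perp X\mid Z$, $P(S=s\mid X=x)=\sum_{z\in[n_z]}P(S=s\mid Z=z)\,P(Z=z\mid X=x)$, and likewise for $Q$. The same $\eta$ is used for $P$ and $Q$. *)

(* Defs.v *)
From HB Require Import structures.
From mathcomp Require Import all_boot all_order all_algebra perm.
From mathcomp Require Import all_classical all_reals all_analysis.

Set Implicit Arguments.
Unset Strict Implicit.
Unset Printing Implicit Defensive.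
Import Order.TTheory GRing.Theory Num.Theory.
Import numFieldNormedType.Exports.

Local Open Scope classical_set_scope.
Local Open Scope ring_scope.

(* A measurableType is pointed, so finite index sets are written 'I_n.+1. *)
HB.instance Definition _ (n : nat) := isPointed.Build 'I_n.+1 ord0.

HB.instance Definition _ (n : nat) := @isMeasurable.Build
  default_measure_display 'I_n.+1 (@discrete_measurable 'I_n.+1)
  (@discrete_measurable0 _) (@discrete_measurableC _)
  (@discrete_measurableU _).

(* R^n with its Borel sigma-algebra. *)
Definition euclid (R : realType) (n : nat) : Type :=
  g_sigma_algebraType (@open 'rV[R]_n).

HB.instance Definition _ (R : realType) (n : nat) :=
  Measurable.on (euclid R n).

Section Joint.
Variables (R : realType) (nx ns nz : nat).

Definition outcome : Type := (euclid R nx * 'I_ns.+1 * 'I_nz.+1)%type.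

HB.instance Definition _ := Measurable.on outcome.

Definition obsX (w : outcome) : euclid R nx := w.1.1.
Definition proxyS (w : outcome) : 'I_ns.+1 := w.1.2.
Definition latentZ (w : outcome) : 'I_nz.+1 := w.2.
Definition obsXS (w : outcome) : (euclid R nx * 'I_ns.+1)%type := w.1.

Lemma measurable_obsXS : measurable_fun [set: outcome] obsXS.
Proof. exact: measurable_fst. Qed.

Lemma measurable_obsX : measurable_fun [set: outcome] obsX.
Proof. exact: (measurableT_comp measurable_fst measurable_fst). Qed.

Lemma measurable_proxyS : measurable_fun [set: outcome] proxyS.
Proof. exact: (measurableT_comp measurable_snd measurable_fst). Qed.

Lemma measurable_latentZ : measurable_fun [set: outcome] latentZ.
Proof. exact: measurable_snd. Qed.

HB.instance Definition _ :=
  isMeasurableFun.Build _ _ _ _ obsXS measurable_obsXS.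
HB.instance Definition _ :=
  isMeasurableFun.Build _ _ _ _ obsX measurable_obsX.
HB.instance Definition _ :=
  isMeasurableFun.Build _ _ _ _ proxyS measurable_proxyS.
HB.instance Definition _ :=
  isMeasurableFun.Build _ _ _ _ latentZ measurable_latentZ.

Implicit Types (P Q : probability outcome R) (XX : set 'rV[R]_nx).

(* P(E | F); it is 0 when P(F) = 0. *)
Definition condP P (E F : set outcome) : R :=
  fine (P (E `&` F)) / fine (P F).

Definition takes_values_in XX P := {ae P, forall w : outcome, XX (obsX w)}.

(* Support of the marginal law of X, in the relative topology of XX. *)
Definition suppX XX P : set 'rV[R]_nx :=
  [set x | XX x /\
    forall U : set 'rV[R]_nx, open U -> U x -> (0 < distribution P obsX U)%E].

Definition same_XS_marginal P Q :=
  forall E : set (euclid R nx * 'I_ns.+1), measurable E ->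
    distribution P obsXS E = distribution Q obsXS E.

(* k is a version, defined at every point, of the conditional law of the
   discrete variable V given X.  Its values outside the support of X are
   irrelevant. *)
Definition cond_law_given_X P m (V : {mfun outcome >-> 'I_m.+1})
    (k : R.-pker euclid R nx ~> 'I_m.+1) :=
  forall (A : set (euclid R nx)) (B : set 'I_m.+1), measurable A ->
    (\int[distribution P obsX]_(x in A) k x B =
     P ((obsX @^-1` A) `&` (V @^-1` B)))%E.

Definition cond_mass m (k : R.-pker euclid R nx ~> 'I_m.+1) (x : 'rV[R]_nx)
    (j : 'I_m.+1) : R :=
  fine (k x [set j]).

(* S and X are independent given Z. *)
Definition structural P :=
  forall (A : set (euclid R nx)) (B : set 'I_ns.+1) (z : 'I_nz.+1),
    measurable A ->
    condP P ((proxyS @^-1` B) `&` (obsX @^-1` A)) (latentZ @^-1` [set z]) =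
    condP P (proxyS @^-1` B) (latentZ @^-1` [set z]) *
    condP P (obsX @^-1` A) (latentZ @^-1` [set z]).

Definition proxy_mx P : 'M[R]_(nz.+1, ns.+1) :=
  \matrix_(z, s) condP P (proxyS @^-1` [set s]) (latentZ @^-1` [set z]).

(* P(S = s | X = x) = sum_z P(S = s | Z = z) P(Z = z | X = x) for every x in
   the support; conditional independence alone gives it only for almost
   every x. *)
Definition mixture_identity XX P (kS : R.-pker euclid R nx ~> 'I_ns.+1)
    (kZ : R.-pker euclid R nx ~> 'I_nz.+1) :=
  forall x, suppX XX P x -> forall s,
    cond_mass kS x s = \sum_z proxy_mx P z s * cond_mass kZ x z.

(* The maximum over the support of P(Z = i | X = x) is at least eta. *)
Definition weak_overlap XX (eta : R) P
    (kZ : R.-pker euclid R nx ~> 'I_nz.+1) :=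
  forall i, exists2 x, suppX XX P x & eta <= cond_mass kZ x i.

End Joint.
Arguments obsX {R nx ns nz}.
Arguments proxyS {R nx ns nz}.
Arguments latentZ {R nx ns nz}.

(* Main.v *)
(* Write p(x), q(x) for the row vectors of conditional laws of Z given X = x
   under P and Q.  Equality of the laws of S given X = x reads
   p(x) M_P = q(x) M_Q, and M_Q has a right inverse, so q(x) = p(x) B for a
   fixed matrix B.  Put eps = (1 - eta) / (2 eta - 1).  At the overlap points
   of P the law p(x) is concentrated on one index, so the rows of B nearly
   inherit stochasticity: they sum to 1 and have entries in [-eps, 1 + eps].
   At the overlap points of Q the average q(x)_j of column j is at least eta,
   so every column of B has an entry at least eta.  If n eps is small, two such
   entries cannot share a row, and B is a permutation matrix up to O(n eps);
   if it is not small, the bound is trivial. *)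
Require Import Defs.
From mathcomp Require Import all_boot all_order all_algebra perm.
From mathcomp Require Import all_classical all_reals all_analysis.
From mathcomp Require Import lra.

Set Implicit Arguments.
Unset Strict Implicit.
Unset Printing Implicit Defensive.
Import Order.TTheory GRing.Theory Num.Theory.
Import numFieldNormedType.Exports.
Local Open Scope classical_set_scope.
Local Open Scope ring_scope.

(** * Averages against probability vectors *)

Section Core.
Variable R : realFieldType.

Definition stochastic n (p : 'rV[R]_n) :=
  (forall i, 0 <= p 0 i) /\ \sum_i p 0 i = 1.

Lemma stochastic_le1 n (p : 'rV[R]_n) i : stochastic p -> p 0 i <= 1.
Proof.
move=> [p0 p1]; rewrite -p1 (bigD1 i) //= lerDl.
by apply: sumr_ge0 => k _; exact: p0.
Qed.

Lemma stochastic_sum_le n (p : 'rV[R]_n) (f : 'I_n -> R) b : stochastic p ->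
  (forall k, f k <= b) -> \sum_k p 0 k * f k <= b.
Proof.
move=> [p0 p1] fb; rewrite -[leRHS]mul1r -p1 mulr_suml.
by apply: ler_sum => k _; apply: ler_wpM2l.
Qed.

(** The gaps [b - f k] are nonnegative, so their average is at least its term at [i], hence at least
    [eta * (b - f i)]. *)
Lemma overlap_sum_le n (p : 'rV[R]_n) (f : 'I_n -> R) i eta b :
    stochastic p -> eta <= p 0 i -> (forall k, f k <= b) ->
  \sum_k p 0 k * f k <= eta * f i + (1 - eta) * b.
Proof.
move=> [p0 p1] etap fb.
have le_i : \sum_k p 0 k * (b - f k) >= eta * (b - f i).
  rewrite (bigD1 i) //= -[leLHS]addr0 lerD //.
    by rewrite ler_wpM2r // subr_ge0.
  by apply: sumr_ge0 => k _; rewrite mulr_ge0 // subr_ge0.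
have E : \sum_k p 0 k * (b - f k) = b - \sum_k p 0 k * f k.
  rewrite -[X in _ = X - _]mul1r -p1 mulr_suml -sumrB.
  by apply: eq_bigr => k _; rewrite mulrBr.
rewrite E in le_i; lra.
Qed.

Lemma overlap_sum_ge n (p : 'rV[R]_n) (f : 'I_n -> R) i eta a :
    stochastic p -> eta <= p 0 i -> (forall k, a <= f k) ->
  eta * f i + (1 - eta) * a <= \sum_k p 0 k * f k.
Proof.
move=> sp etap fa; rewrite -lerN2 -sumrN.
under eq_bigr do rewrite -mulrN.
have /= := @overlap_sum_le n p (fun k => - f k) i eta (- a) sp etap.
rewrite !mulrN opprD; apply => k; by rewrite lerN2.
Qed.

(** * The transition matrix between the two latent laws *)

Section Transition.
Variables (n : nat) (eta : R) (T : Type) (D : T -> Prop).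
Variables (p q : T -> 'rV[R]_n) (B : 'M[R]_n).
Hypotheses (eta_gt : 2^-1 < eta) (eta_le1 : eta <= 1).
Hypotheses (p_stoch : forall x, D x -> stochastic (p x))
           (q_stoch : forall x, D x -> stochastic (q x)).
Hypothesis qE : forall x, D x -> q x = p x *m B.
Hypothesis p_overlap : forall i, exists2 x, D x & eta <= p x 0 i.
Hypothesis q_overlap : forall i, exists2 x, D x & eta <= q x 0 i.

Let eps : R := (1 - eta) / (2 * eta - 1).

Let den_gt0 : 0 < 2 * eta - 1.
Proof. move: eta_gt; lra. Qed.

(** The smallest entry [a] and the largest entry [b] are bounded together: overlap at the row of
    each gives one linear inequality in both. The determinant of this system,
    [eta^2 - (1 - eta)^2 = 2 * eta - 1], is the denominator of [eps]. *)
Lemma transition_entry_bounds i j : - eps <= B i j <= 1 + eps.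
Proof.
case: (arg_minP (fun u : 'I_n * 'I_n => B u.1 u.2) (i0 := (i, j))
  (P := predT) isT) => -[i0 j0] _ /= min_ij.
case: (arg_maxP (fun u : 'I_n * 'I_n => B u.1 u.2) (i0 := (i, j))
  (P := predT) isT) => -[i1 j1] _ /= max_ij.
set a : R := B i0 j0 in min_ij; set b : R := B i1 j1 in max_ij.
have {}min_ij k l : a <= B k l by exact: (min_ij (k, l)).
have {}max_ij k l : B k l <= b by exact: (max_ij (k, l)).
have lo : 0 <= eta * a + (1 - eta) * b.
  have [x Dx ex] := p_overlap i0.
  have := (q_stoch Dx).1 j0; rewrite qE // mxE => /le_trans; apply.
  exact: (overlap_sum_le (f := B^~ j0) (p_stoch Dx) ex).
have hi : eta * b + (1 - eta) * a <= 1.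
  have [x Dx ex] := p_overlap i1.
  apply: le_trans (stochastic_le1 j1 (q_stoch Dx)); rewrite qE // mxE.
  exact: (overlap_sum_ge (f := B^~ j1) (p_stoch Dx) ex).
have epsE : eps * (2 * eta - 1) = 1 - eta by rewrite divfK // gt_eqF.
(* Eliminate b, resp. a, between the two inequalities lo and hi. *)
move: eps epsE den_gt0 eta_gt eta_le1 => e epsE d0 eta2 eta1.
apply/andP; split.
  apply: le_trans (min_ij i j).
  by rewrite -(ler_pM2r d0) mulNr; nra.
apply: le_trans (max_ij i j) _.
by rewrite -(ler_pM2r d0) mulrDl; nra.
Qed.

Lemma transition_row_sum i : \sum_j B i j = 1.
Proof.
pose v k := \sum_j B k j.
have pv x : D x -> \sum_k p x 0 k * v k = 1.
  move=> Dx; rewrite -(q_stoch Dx).2 qE //.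
  under [RHS]eq_bigr do rewrite mxE.
  rewrite exchange_big; apply: eq_bigr => k _.
  by rewrite mulr_sumr.
rewrite -/(v i).
case: (arg_minP v (i0 := i) (P := predT) isT) => i0 _ min_v.
case: (arg_maxP v (i0 := i) (P := predT) isT) => i1 _ max_v.
have {}min_v k : v i0 <= v k by exact: min_v.
have {}max_v k : v k <= v i1 by exact: max_v.
(* The average of v is 1 both near its minimum and near its maximum. *)
have [x Dx ex] := p_overlap i0.
have lo := overlap_sum_le (p_stoch Dx) ex max_v.
have [y Dy ey] := p_overlap i1.
have hi := overlap_sum_ge (p_stoch Dy) ey min_v.
rewrite pv // in lo; rewrite pv // in hi.
(* Combining [lo] and [hi] gives [(2 * eta - 1) * (v i1 - v i0) <= 0]. *)
have v10 : v i1 = v i0.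
  by apply: le_anti; rewrite max_v andbT; move: eta_gt; nra.
rewrite v10 in lo hi max_v; have := min_v i; have := max_v i; lra.
Qed.

Lemma transition_col_large j : exists i, eta <= B i j.
Proof.
have [x Dx ex] := q_overlap j.
case: (arg_maxP (B^~ j) (i0 := j) (P := predT) isT) => i _ max_i.
exists i; apply: le_trans ex _; rewrite qE // mxE.
by apply: (stochastic_sum_le (p_stoch Dx)) => k; exact: max_i.
Qed.

Let eps_ge : 1 - eta <= eps.
Proof. by rewrite ler_pdivlMr //; move: eta_gt eta_le1; nra. Qed.

Let eps_ge0 : 0 <= eps.
Proof. by apply: le_trans eps_ge; rewrite subr_ge0. Qed.

(** The row sums to 1 and each remaining entry is at least [- eps]; their number is bounded crudely
    by [n]. *)
Lemma transition_row_two i j l : j != l ->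
  B i j + B i l <= 1 + n%:R * eps.
Proof.
move=> jl.
have := transition_row_sum i; rewrite (bigD1 j) //= (bigD1 l) 1?eq_sym //=.
have : - (n%:R * eps) <= \sum_(k < n | (k != j) && (k != l)) B i k.
  apply: (@le_trans _ _ (\sum_(k < n | (k != j) && (k != l)) - eps)).
    rewrite sumr_const mulNrn lerN2 -[leLHS]mulr_natl ler_wpM2r // ler_nat.
    by rewrite -[leqRHS]card_ord max_card.
  by apply: ler_sum => k _; have /andP[] := transition_entry_bounds i k.
lra.
Qed.

Lemma permutation_near :
  exists s : 'S_n, forall x i, D x ->
    `|p x 0 i - q x 0 (s i)| <= 2 * n%:R * eps.
Proof.
have [large|small] := lerP 1 (2 * n%:R * eps).
  exists 1%g => x i Dx; apply: le_trans large; rewrite perm1.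
  have := stochastic_le1 i (p_stoch Dx); have := stochastic_le1 i (q_stoch Dx).
  have := (p_stoch Dx).1 i; have := (q_stoch Dx).1 i.
  by rewrite ler_norml; lra.
have /fin_all_exists [r rP] := transition_col_large.
(* Two entries at least [eta] in one row would give [2 * eta - 1 <= n * eps < 1/2]. As also
   [eps < 1/2], the product [eps * (2 * eta - 1) = 1 - eta] is at most 1/4, so [2 * eta - 1 >= 1/2],
   a contradiction. *)
have r_inj : injective r.
  move=> j l rjl; apply/eqP/negPn/negP => jl.
  have := transition_row_two (r j) jl; have := rP j; have := rP l.
  rewrite -rjl.
  have n1 : 1 <= n%:R :> R by rewrite ler1n; case: (n) j {l rjl jl} => // -[].
  have epsE : eps * (2 * eta - 1) = 1 - eta by rewrite divfK // gt_eqF.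
  have : 1 * eps <= n%:R * eps by rewrite ler_wpM2r.
  rewrite -mulrA in small; move: small epsE eps_ge0 den_gt0.
  move: (n%:R * eps) eps => y e small epsE e0 d0 ey by1 by2 by3.
  have : e * (2 * eta - 1) <= 2^-1 * 2^-1 by apply: ler_pM => //; lra.
  by rewrite epsE; lra.
(* [r] sends a column to the row of its large entry, so [s i] is the column whose large entry lies
   in row [i]. *)
pose s := (perm r_inj)^-1%g.
have rs i : r (s i) = i by rewrite -(permE r_inj) permKV.
exists s => x i Dx.
(* On the diagonal the entry lies in [[eta, 1 + eps]]. Off it, row [k] already has a large entry at
   [s k], which leaves at most [1 + n * eps - eta <= (n + 1) * eps]; hence the factor 2. *)
have near k : `|(k == i)%:R - B k (s i)| <= 2 * n%:R * eps.
  have n1 : 1 <= n%:R :> R by rewrite ler1n; case: (n) k => // -[].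
  have e2 : eps <= n%:R * eps by rewrite -[leLHS]mul1r ler_wpM2r.
  have /andP[lo hi] := transition_entry_bounds k (s i).
  have [ki|ki] := eqVneq k i.
    have := rP (s i); rewrite rs -ki => h; rewrite /= ler_norml -mulrA.
    by move: eps_ge eps_ge0; rewrite -ki in lo hi; lra.
  have ne : s k != s i by rewrite (inj_eq perm_inj).
  have := transition_row_two k ne; have := rP (s k); rewrite rs => h1 h2.
  by move: eps_ge eps_ge0; rewrite /= ler_norml -mulrA; lra.
have -> : p x 0 i - q x 0 (s i) = \sum_k p x 0 k * ((k == i)%:R - B k (s i)).
  rewrite qE // mxE; under [RHS]eq_bigr do rewrite mulrBr.
  rewrite sumrB [X in _ = X - _](bigD1 i) //= eqxx mulr1 [X in _ = _ + X - _]big1 ?addr0 // => k /negPf ->.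
  by rewrite mulr0.
apply: le_trans (ler_norm_sum _ _ _) _.
under eq_bigr do rewrite normrM ger0_norm ?(p_stoch Dx).1 //.
exact: (stochastic_sum_le (p_stoch Dx)).
Qed.

End Transition.
End Core.

(** * From measures and kernels to probability vectors *)

Section Bridge.
Variables (R : realType) (nx ns nz : nat).
Implicit Types P Q : probability (outcome R nx ns nz) R.

(** Assumptions on [Q] refer to its own support; this moves them to that of [P]. Open sets are
    Borel, and the law of X is the image of the law of (X, S). *)
Lemma suppX_same_XS XX P Q : same_XS_marginal P Q ->
  suppX XX P = suppX XX Q.
Proof.
move=> PQ; rewrite /suppX; apply/seteqP.
have eX (U : set 'rV[R]_nx) : open U -> distribution P obsX U = distribution Q obsX U.
  move=> oU; have mU : measurable (U : set (euclid R nx)).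
    exact: sub_sigma_algebra.
  have := PQ (fst @^-1` (U : set (euclid R nx))); rewrite /distribution /=.
  apply; rewrite -[X in measurable X]setTI; exact: measurable_fst.
by split=> x [Xx h]; split=> // U oU Ux; [rewrite -eX|rewrite eX] => //; exact: h.
Qed.

Lemma measure_ord_stochastic m (mu : {measure set 'I_m.+1 -> \bar R}) :
  mu [set: 'I_m.+1] = 1%E -> stochastic (\row_j fine (mu [set j])).
Proof.
move=> mu1; have muj_fin j : mu [set j] \is a fin_num.
  rewrite ge0_fin_numE //; apply: (@le_lt_trans _ _ 1%E); last exact: ltry.
  by rewrite -mu1 le_measure // inE.
split=> [i|]; first by rewrite mxE fine_ge0.
under eq_bigr do rewrite mxE.
have coverT : \big[setU/set0]_(j < m.+1) [set j] = [set: 'I_m.+1].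
  by apply/seteqP; split=> // j _; rewrite (bigD1 j) //=; left.
have sum_mu : (\sum_j mu [set j] = 1)%E.
  rewrite -mu1 -coverT measure_bigsetU_ord //.
  by move=> i j _ _ [_ [-> ->]].
by rewrite sum_fine // sum_mu.
Qed.

Lemma cond_mass_stochastic m (k : R.-pker euclid R nx ~> 'I_m.+1) x :
  stochastic (\row_j cond_mass k x j).
Proof. by apply: (@measure_ord_stochastic _ (k x)); apply: prob_kernel. Qed.

End Bridge.

Theorem theorem1 (R : realType) (nz : nat) :
  exists C : R,
  forall (nx ns : nat) (XX : set 'rV[R]_nx) (eta : R)
    (P Q : probability (outcome R nx ns nz.+1) R)
    (PS QS : R.-pker euclid R nx ~> 'I_ns.+1)
    (PZ QZ : R.-pker euclid R nx ~> 'I_nz.+2),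
  2^-1 < eta -> eta <= 1 ->
  takes_values_in XX P -> takes_values_in XX Q ->
  cond_law_given_X P proxyS PS -> cond_law_given_X P latentZ PZ ->
  cond_law_given_X Q proxyS QS -> cond_law_given_X Q latentZ QZ ->
  same_XS_marginal P Q ->
  (forall x, suppX XX P x -> forall s, cond_mass PS x s = cond_mass QS x s) ->
  mixture_identity XX P PS PZ -> mixture_identity XX Q QS QZ ->
  structural P -> structural Q ->
  \rank (proxy_mx P) = nz.+2 -> \rank (proxy_mx Q) = nz.+2 ->
  weak_overlap XX eta P PZ -> weak_overlap XX eta Q QZ ->
  exists pi : 'S_nz.+2, forall i : 'I_nz.+2,
    (ereal_sup [set `|cond_mass PZ x i - cond_mass QZ x (pi i)|%:E | x in suppX XX P] <=
     (C * ((1 - eta) / (2 * eta - 1)))%:E)%E.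
Proof.
exists (2 * nz.+2%:R) => nx ns XX eta P Q PS QS PZ QZ eta2 eta1 _ _ _ _ _ _ PQ.
move=> eS mixP mixQ _ _ _ /eqP rkQ ovP ovQ.
have {}rkQ : row_free (proxy_mx Q) by [].
have suppE := suppX_same_XS XX PQ.
pose row_mass (k : R.-pker euclid R nx ~> 'I_nz.+2) x := \row_j cond_mass k x j.
(* Full row rank makes [pinvmx (proxy_mx Q)] a right inverse, which cancels [proxy_mx Q] in the
   equality of the two mixtures. *)
have qE x : suppX XX P x ->
    row_mass QZ x = row_mass PZ x *m (proxy_mx P *m pinvmx (proxy_mx Q)).
  move=> Px; rewrite mulmxA.
  suff -> : row_mass PZ x *m proxy_mx P = row_mass QZ x *m proxy_mx Q.
    by rewrite -mulmxA mulmxVp // mulmx1.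
  apply/rowP => s; rewrite !mxE.
  under eq_bigr do rewrite mxE mulrC.
  under [RHS]eq_bigr do rewrite mxE mulrC.
  by rewrite -mixP // -mixQ -?suppE // eS.
have [||||s sP] := @permutation_near R nz.+2 eta _ (suppX XX P)
  (row_mass PZ) (row_mass QZ) _ eta2 eta1 _ _ qE.
- by move=> x _; exact: cond_mass_stochastic.
- by move=> x _; exact: cond_mass_stochastic.
- by move=> i; have [x Px ?] := ovP i; exists x; rewrite ?mxE.
- by move=> i; have [x Qx ?] := ovQ i; exists x; rewrite ?mxE ?suppE.
exists s => i; apply: ge_ereal_sup => _ [x Px <-].
by rewrite lee_fin; have := sP x i Px; rewrite !mxE.
Qed.
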